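(* Endow $\bar X$ with the QED metric $\bar d_2$. At a generic point $\bar x\in\bar X$ the shape space is locally $CAT(0)$, and thus $\bar X$ has locally unique geodesics in a neighborhood of $\bar x$.
   Context: Setting. Fix integers $d,n\ge 1$ (in the paper $d=2$ or $3$) and a finite rooted ordered (planar) binary tree $\mathscr T=(V,E,r)$ with $E\neq\emptyset$: every non-leaf vertex has exactly two children, and the children of each vertex are totally ordered. The tree pre-shape space is $X=\prod_{e\in E}(\mathbb R^d)^n$, with elements $x=(x_e)_{e\in E}$ and metric $d_2(x,y)=\sqrt{\sum_{e\in E}\|x_e-y_e\|^2}$, where $\|\cdot\|$ is the Euclidean norm on $(\mathbb R^d)^n$. Equivalence. For $x\in X$, the collapsed tree of $x$ is the rooted ordered tree with edge attributes obtained from $\mathscr T$ by contracting every edge $e$ with $x_e=0$ (when an edge from $u$ down to $v$ is contracted, the children of $v$ are inserted, in order, at the position of $v$ among the children of $u$) and keeping the attribute $x_e$ on each remaining edge. Put $x\sim y$ iff the collapsed trees of $x$ and $y$ are isomorphic as rooted ordered trees with edge attributes. The space of ordered tree-like shapes is $\bar X=X/\sim$; write $\bar x$ for the class of $x$. Quotient metric. The QED metric is $$\bar d_2(\bar x,\bar y)=\inf\Big\{\sum_{i=1}^k d_2(x_i,y_i)\ :\ k\ge 1,\ x_1\in\bar x,\ y_i\sim x_{i+1}\ (1\le i<k),\ y_k\in\bar y\Big\}.$$ Generic. ''A generic point has property $P$'' means that $P$ holds on an open dense subset of the space. A metric space is $CAT(0)$ if it is geodesic and for every geodesic triangle the distance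 from a vertex to a point on the opposite side is at most the corresponding distance in a planar Euclidean triangle with the same side lengths. A space is locally $CAT(0)$ at a point if some ball around that point is $CAT(0)$. Geodesics are locally unique at a point if the point has a sufficiently small neighborhood within which any two points are joined by a unique geodesic. *)

(* Defs.v *)
From HB Require Import structures.
From mathcomp Require Import all_boot all_order all_algebra generic_quotient.
From mathcomp Require Import all_classical all_reals topology normedtype.
Set Implicit Arguments.
Unset Strict Implicit.
Unset Printing Implicit Defensive.
Import Order.TTheory GRing.Theory Num.Theory.
Import numFieldNormedType.Exports.
Local Open Scope classical_set_scope.
Local Open Scope ring_scope.
Local Open Scope quotient_scope.

(* The Euclidean norm; the norm [`|A|] of the library is the sup norm on
   matrices. *)
Definition enorm (R : realType) (p q : nat) (A : 'M[R]_(p, q)) : R :=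
  Num.sqrt (\sum_i \sum_j A i j ^+ 2).

Section MetricGeometry.
Context {R : realType} {M : metricType R}.
Implicit Types (S U : set M) (x y p q r : M) (g : R -> M).

(* Only the values of [g] on [0, mdist x y] matter. *)
Definition geodesic x y g : Prop :=
  [/\ g 0 = x, g (mdist x y) = y &
      {in `[0, mdist x y] &, forall s t, mdist (g s) (g t) = `|s - t|}].

Definition geodesic_in S x y g : Prop :=
  geodesic x y g /\ {in `[0, mdist x y], forall s, S (g s)}.

Definition geodesic_space S : Prop :=
  forall x y, S x -> S y -> exists g, geodesic_in S x y g.

(* The subset [S], with the restricted metric, is a CAT(0) space.  The triangle
   [P Q C] is a comparison triangle for [p q r]; the point at parameter
   [l * mdist q r] of the side from [q] to [r] is compared with the point of
   the segment from [Q] to [C] dividing it in the same ratio. *)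
Definition CAT0 S : Prop :=
  geodesic_space S /\
  forall p q r gpq gqr gpr,
    S p -> S q -> S r ->
    geodesic_in S p q gpq -> geodesic_in S q r gqr -> geodesic_in S p r gpr ->
  forall P Q C : 'rV[R]_2,
    enorm (P - Q) = mdist p q -> enorm (Q - C) = mdist q r ->
    enorm (P - C) = mdist p r ->
  forall l : R, 0 <= l <= 1 ->
    mdist p (gqr (l * mdist q r)) <= enorm (P - ((1 - l) *: Q + l *: C)).

Definition locally_CAT0 x : Prop := exists2 e : R, 0 < e & CAT0 (ball x e).

(* The geodesic joining two points of [U] stays in [U] and is unique among all
   geodesics of the ambient space. *)
Definition locally_unique_geodesics x : Prop :=
  exists2 U, nbhs x U & forall y z, U y -> U z ->
    exists2 g, geodesic_in U y z g &
      forall g', geodesic y z g' -> {in `[0, mdist y z], g' =1 g}.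

End MetricGeometry.

Definition generic (T : topologicalType) (P : T -> Prop) : Prop :=
  exists U : set T, [/\ open U, dense U & forall x, U x -> P x].

(* Finite rooted ordered binary trees. *)
Inductive bintree : Type := leaf | node of bintree & bintree.

(* In [node l r], [inl None] is the edge from the root to the root of [l] and
   [inl (Some e)] is the edge [e] of [l]; similarly for [inr] and [r]. *)
Fixpoint edge (t : bintree) : finType :=
  match t with
  | leaf => void
  | node l r => (option (edge l) + option (edge r))%type
  end.

(* Finite rooted ordered trees with edge attributes in [A]: a root is given by
   the sequence of its children, each with the attribute of the edge leading to
   it.  Vertices carry no names, so isomorphism of such trees is equality. *)
Inductive otree (A : Type) : Type := ONode of seq (A * otree A).
Arguments ONode {A} _.

(* The sequence contributed to the children of the upper end of an edge of
   attribute [a], when [cs] are the children of the lower end. *)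
Definition contract (V : zmodType) (a : V) (cs : seq (V * otree V)) :
    seq (V * otree V) :=
  if a == 0 then cs else [:: (a, ONode cs)].

Fixpoint collapse_children (V : zmodType) (t : bintree) :
    (edge t -> V) -> seq (V * otree V) :=
  match t with
  | leaf => fun=> [::]
  | node l r => fun x =>
      contract (x (inl None)) (collapse_children (fun e => x (inl (Some e)))) ++
      contract (x (inr None)) (collapse_children (fun e => x (inr (Some e))))
  end.

Definition collapsed_tree (V : zmodType) (t : bintree) (x : edge t -> V) :
    otree V :=
  ONode (collapse_children x).

(* Auxiliary notions for the separation property of the quotient metric. *)
Section Forests.
Context {V : zmodType}.
Notation forest := (seq (V * otree V)).

Lemma forest_ind (P : forest -> Prop) : P [::] ->
  (forall a f g, P f -> P g -> P ((a, ONode f) :: g)) -> forall f, P f.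
Proof.
move=> P0 PS.
have Pt : forall t : otree V, let: ONode f := t in P f.
  fix IHt 1; case; elim => [//|[a t] g IHg].
  by have := IHt t; case: t => f Pf; exact: PS.
by move=> f; exact: (Pt (ONode f)).
Qed.

Fixpoint osize (t : otree V) : nat :=
  let: ONode f := t in sumn [seq (osize p.2).+1 | p <- f].

Definition fsize (f : forest) : nat := sumn [seq (osize p.2).+1 | p <- f].

Lemma fsize_cons a f g : fsize ((a, ONode f) :: g) = (fsize f + fsize g).+1.
Proof. by []. Qed.

Lemma fsize_cat f g : fsize (f ++ g) = (fsize f + fsize g)%N.
Proof. by rewrite /fsize map_cat sumn_cat. Qed.

Fixpoint oprune (t : otree V) : forest :=
  let: ONode f := t in flatten [seq contract p.1 (oprune p.2) | p <- f].

Definition prune (f : forest) : forest := oprune (ONode f).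

Lemma prune_cons a f g :
  prune ((a, ONode f) :: g) = contract a (prune f) ++ prune g.
Proof. by []. Qed.

Lemma prune_cat f g : prune (f ++ g) = prune f ++ prune g.
Proof. by rewrite /prune/= map_cat flatten_cat. Qed.

Fixpoint full (t : bintree) : (edge t -> V) -> forest :=
  match t with
  | leaf => fun=> [::]
  | node l r => fun x =>
      [:: (x (inl None), ONode (full (fun e => x (inl (Some e)))));
          (x (inr None), ONode (full (fun e => x (inr (Some e)))))]
  end.

Lemma prune_full t (x : edge t -> V) : prune (full x) = collapse_children x.
Proof.
elim: t x => [//|l IHl r IHr] x /=.
by rewrite !prune_cons IHl IHr [prune [::]]/= cats0.
Qed.

End Forests.

Section Closeness.
Context {R : realType} {p q : nat}.
Notation V := 'M[R]_(p, q).
Notation forest := (seq (V * otree V)).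
Implicit Types (f g h : forest) (s d : R).

Inductive close s : forest -> forest -> Prop :=
| close_nil : close s [::] [::]
| close_keep a b f f' g g' : `|a - b| <= s -> close s f f' -> close s g g' ->
    close s ((a, ONode f) :: g) ((b, ONode f') :: g')
| close_skip b f g' g : `|b| <= s -> close s f (g' ++ g) ->
    close s f ((b, ONode g') :: g).

Inductive nearf d : forest -> forest -> Prop :=
| nearf_nil : nearf d [::] [::]
| nearf_cons a b f f' g g' : `|a - b| <= d -> nearf d f f' -> nearf d g g' ->
    nearf d ((a, ONode f) :: g) ((b, ONode f') :: g').

Inductive large s : forest -> Prop :=
| large_nil : large s [::]
| large_cons a f g : s < `|a| -> large s f -> large s g ->
    large s ((a, ONode f) :: g).

Lemma large_le s s' f : s <= s' -> large s' f -> large s f.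
Proof.
by move=> ss'; elim; constructor => //; apply: le_lt_trans ss' _.
Qed.

Lemma large_cat s f g : large s f -> large s g -> large s (f ++ g).
Proof. by move=> + bg; elim=> [//|a f1 f2 ? ? ? ? ?] /=; constructor. Qed.

Lemma large_collapse s t (x : edge t -> V) :
  (forall e, x e != 0 -> s < `|x e|) -> large s (collapse_children x).
Proof.
elim: t x => [|l IHl r IHr] x sx /=; first exact: large_nil.
apply: large_cat; rewrite /contract; case: eqP => [_|/eqP x0].
- by apply: IHl => e; apply: sx.
- by constructor; [exact: sx | apply: IHl => e; apply: sx | constructor].
- by apply: IHr => e; apply: sx.
- by constructor; [exact: sx | apply: IHr => e; apply: sx | constructor].
Qed.

Lemma nearf_cat d f f' g g' :
  nearf d f f' -> nearf d g g' -> nearf d (f ++ g) (f' ++ g').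
Proof. by move=> + ng; elim => [//|*] /=; constructor. Qed.

Lemma nearf_full d t (x y : edge t -> V) : (forall e, `|x e - y e| <= d) ->
  nearf d (full x) (full y).
Proof.
elim: t x y => [|l IHl r IHr] x y xy /=; first exact: nearf_nil.
by do 3?constructor => //; [apply: IHl | apply: IHr].
Qed.

Lemma nearf_eq (e : R) f g : 0 < e ->
  (forall d, 0 < d < e -> nearf d f g) -> f = g.
Proof.
move=> e0; have e2 : 0 < e / 2 < e.
  by rewrite divr_gt0//= ltr_pdivrMr// ltr_pMr// ltr1n.
elim/(@forest_ind 'M[R]_(p, q)): f g => [|a f1 f2 IH1 IH2] g fg.
  by have := fg _ e2; inversion 1.
have := fg _ e2; inversion 1 as [|? b ? g1 ? g2 _ _ _ ]; subst.
have {}fg d : 0 < d < e -> [/\ `|a - b| <= d, nearf d f1 g1 & nearf d f2 g2].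
  by move/fg; inversion 1.
rewrite (IH1 g1) => [|d /fg[]//]; rewrite (IH2 g2) => [|d /fg[]//].
suff -> : a = b by [].
apply/eqP; rewrite -subr_eq0 -normr_le0; apply/ler_addgt0Pl => /= d d0.
rewrite addr0; have dm : 0 < Num.min d (e / 2) < e.
  by case/andP: e2 => e20 e2e; rewrite lt_min d0 e20 gt_min e2e orbT.
by have [/le_trans-> //] := fg _ dm; rewrite ge_min lexx.
Qed.

Lemma close_refl s f : 0 <= s -> close s f f.
Proof.
move=> s0; elim/(@forest_ind 'M[R]_(p, q)): f => [|a f g ? ?].
  exact: close_nil.
by constructor => //; rewrite subrr normr0.
Qed.

Lemma close_unprune s f h : 0 <= s -> close s f (prune h) -> close s f h.
Proof.
move=> s0; have [k] := ubnP (fsize h).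
elim: k f h => // k IH f [//|[b [h1]] h2].
rewrite fsize_cons ltnS => hk; rewrite prune_cons /contract.
case: eqP => [->|b0 /=].
  rewrite -prune_cat => /(IH _ (h1 ++ h2)).
  by rewrite fsize_cat hk => /(_ isT) ?; apply: close_skip; rewrite ?normr0.
inversion 1 as [|? ? f1 ? f2 ? ab c1 c2|? ? ? ? bs c]; subst.
- apply: close_keep => //; apply: IH => //; apply: leq_ltn_trans _ hk.
  + exact: leq_addr.
  + exact: leq_addl.
- apply: close_skip => //; apply: IH; first by rewrite fsize_cat.
  by rewrite prune_cat.
Qed.

Lemma close_prune s f h : large s f -> close s f h -> close s f (prune h).
Proof.
move=> bf fh; elim: fh bf => {f h}
  [|a b f f' g g' ab _ IHf _ IHg|b f g' g bs _ IH] bf.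
- exact: close_nil.
- inversion bf as [|? ? ? sa b1 b2]; subst; rewrite prune_cons /contract.
  case: eqP ab => [->|_ ab /=].
    by rewrite subr0 leNgt sa.
  by apply: close_keep => //; [exact: IHf|exact: IHg].
- rewrite prune_cons /contract; have := IH bf; rewrite prune_cat.
  by case: eqP => //= _ ?; apply: close_skip.
Qed.

Lemma close_nearf s d f h h' : 0 <= d ->
  close s f h -> nearf d h h' -> close (s + d) f h'.
Proof.
move=> d0 fh; elim: fh h' => {f h}
  [|a b f f' g g' ab _ IHf _ IHg|b f g' g bs _ IH] h'.
- by inversion 1; constructor.
- inversion 1 as [|? c ? h1 ? h2 bc]; subst; apply: close_keep.
  + by rewrite (le_trans (ler_distD b _ _))// lerD.
  + exact: IHf.
  + exact: IHg.
- inversion 1 as [|? c ? h1 ? h2 bc]; subst; apply: close_skip.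
  + rewrite -[c](subKr b) (le_trans (ler_normB _ _))// lerD//.
  + by apply: IH; apply: nearf_cat.
Qed.

Lemma close_large s f g : large s g -> close s f g -> nearf s f g.
Proof.
move=> bg fg; elim: fg bg => {f g}
  [|a b f f' g g' ab _ IHf _ IHg|b f g' g bs _ _] bg.
- exact: nearf_nil.
- by inversion bg; subst; apply: nearf_cons; [|exact: IHf|exact: IHg].
- by inversion bg as [|? ? ? sb]; subst; move: bs; rewrite leNgt sb.
Qed.

End Closeness.

Section TreeShapes.
Context {R : realType} {d n : nat} {T : bintree}.

(* [(R^d)^n] is the space of [n x d] matrices. *)
Definition tree_preshape : Type := {ffun edge T -> 'M[R]_(n, d)}.
HB.instance Definition _ := Choice.on tree_preshape.

Definition d2 (x y : tree_preshape) : R :=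
  Num.sqrt (\sum_(e : edge T) enorm (x e - y e) ^+ 2).

Definition tree_equivb (x y : tree_preshape) : bool :=
  `[< collapsed_tree x = collapsed_tree y >].

Lemma tree_equivb_equiv : equiv_class_of tree_equivb.
Proof.
split=> [x|x y|y x z]; rewrite /tree_equivb.
- exact/asboolP.
- by apply/asboolP/asboolP.
- by move=> /asboolP xy /asboolP yz; apply/asboolP; rewrite xy.
Qed.

Canonical tree_equiv : equiv_rel tree_preshape :=
  EquivRelPack tree_equivb_equiv.

Definition tree_shape : Type := {eq_quot tree_equiv}.
HB.instance Definition _ := Choice.on tree_shape.

Definition to_shape (x : tree_preshape) : tree_shape :=
  \pi_{eq_quot tree_equiv} x.

Lemma to_shapeP (x y : tree_preshape) :
  to_shape x = to_shape y <-> collapsed_tree x = collapsed_tree y.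
Proof.
rewrite /to_shape; split => [/eqmodP/asboolP//|xy].
by apply/eqmodP/asboolP.
Qed.

(* [x] and [y] are indexed from [1] to [k]; other values are irrelevant. *)
Definition chain (a b : tree_shape) (k : nat)
    (x y : nat -> tree_preshape) : Prop :=
  [/\ (1 <= k)%N, to_shape (x 1%N) = a,
      forall i, (1 <= i < k)%N -> tree_equiv (y i) (x i.+1) &
      to_shape (y k) = b].

Definition lengths (a b : tree_shape) : set R :=
  [set s | exists k x y,
     chain a b k x y /\ s = \sum_(1 <= i < k.+1) d2 (x i) (y i)].

Definition qed_dist (a b : tree_shape) : R := inf (lengths a b).

Lemma d2_ge0 (x y : tree_preshape) : 0 <= d2 x y.
Proof. exact: sqrtr_ge0. Qed.

Lemma d2xx (x : tree_preshape) : d2 x x = 0.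
Proof.
rewrite /d2 big1 ?sqrtr0// => e _; rewrite subrr /enorm big1 ?sqrtr0 ?expr0n//.
by move=> i _; rewrite big1// => j _; rewrite mxE expr0n.
Qed.

Lemma d2C (x y : tree_preshape) : d2 x y = d2 y x.
Proof.
rewrite /d2; congr Num.sqrt; apply: eq_bigr => e _; congr (_ ^+ 2).
rewrite /enorm; congr Num.sqrt; apply: eq_bigr => i _; apply: eq_bigr => j _.
by rewrite !mxE -sqrrN opprB.
Qed.

Lemma normr_le_enorm (p q : nat) (A : 'M[R]_(p, q)) : `|A| <= enorm A.
Proof.
rewrite /Num.norm/= mx_normrE; apply: bigmax_le => [|[i j] _ /=].
  exact: sqrtr_ge0.
rewrite -sqrtr_sqr ler_sqrt; last first.
  by apply: sumr_ge0 => ? _; apply: sumr_ge0 => ? _; apply: sqr_ge0.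
rewrite (bigD1 i)//= (bigD1 j)//= -addrA lerDl addr_ge0//.
  by apply: sumr_ge0 => ? _; apply: sqr_ge0.
by apply: sumr_ge0 => ? _; apply: sumr_ge0 => ? _; apply: sqr_ge0.
Qed.

Lemma normr_le_d2 (x y : tree_preshape) e : `|x e - y e| <= d2 x y.
Proof.
apply: le_trans (normr_le_enorm _) _.
have e0 : 0 <= enorm (x e - y e) by exact: sqrtr_ge0.
rewrite -(ger0_norm e0) -sqrtr_sqr ler_sqrt; last first.
  by apply: sumr_ge0 => ? _; apply: sqr_ge0.
by rewrite (bigD1 e)//= lerDl; apply: sumr_ge0 => ? _; apply: sqr_ge0.
Qed.

Lemma tree_equivE (x y : tree_preshape) :
  tree_equiv x y <-> to_shape x = to_shape y.
Proof. by rewrite to_shapeP; split => /asboolP. Qed.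

Lemma to_shape_surj (a : tree_shape) : exists x : tree_preshape, to_shape x = a.
Proof. by exists (repr a); rewrite /to_shape reprK. Qed.

Let lengths_ge0 a b : lbound (lengths a b) 0.
Proof.
by move=> _ [k [x [y [_ ->]]]]; apply: sumr_ge0 => i _; apply: d2_ge0.
Qed.

Let lengths_has_lbound a b : has_lbound (lengths a b).
Proof. by exists 0; apply: lengths_ge0. Qed.

Lemma chain1 (x y : tree_preshape) :
  chain (to_shape x) (to_shape y) 1 (fun=> x) (fun=> y).
Proof. by split => // i /andP[]; case: i => // i; rewrite ltnS. Qed.

Let lengths_neq0 a b : lengths a b !=set0.
Proof.
have [x <-] := to_shape_surj a; have [y <-] := to_shape_surj b.
exists (\sum_(1 <= i < 2) d2 x y), 1%N, (fun=> x), (fun=> y).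
by split=> //; apply: chain1.
Qed.

Let lengths_has_inf a b : has_inf (lengths a b).
Proof. by split; [exact: lengths_neq0|exact: lengths_has_lbound]. Qed.

Lemma qed_dist_ge0 a b : 0 <= qed_dist a b.
Proof. by apply: lb_le_inf; [exact: lengths_neq0|exact: lengths_ge0]. Qed.

Lemma qed_dist_le_chain a b k x y : chain a b k x y ->
  qed_dist a b <= \sum_(1 <= i < k.+1) d2 (x i) (y i).
Proof.
move=> c; apply: ge_inf; first exact: lengths_has_lbound.
by exists k, x, y.
Qed.

Lemma qed_dist_le_d2 (x y : tree_preshape) :
  qed_dist (to_shape x) (to_shape y) <= d2 x y.
Proof. by have := qed_dist_le_chain (chain1 x y); rewrite big_nat1. Qed.

Lemma qed_dist_lt a b (s : R) : qed_dist a b < s ->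
  exists k x y, chain a b k x y /\ \sum_(1 <= i < k.+1) d2 (x i) (y i) < s.
Proof.
rewrite -subr_gt0 => ab; have [_ [k [x [y [c ->]]]]] :=
  inf_adherent ab (lengths_has_inf a b).
by rewrite addrC subrK => ?; exists k, x, y.
Qed.

Lemma qed_distxx a : qed_dist a a = 0.
Proof.
have [x <-] := to_shape_surj a; apply/eqP; rewrite eq_le qed_dist_ge0 andbT.
by rewrite -(d2xx x) qed_dist_le_d2.
Qed.

Let qed_dist_le_sym a b : qed_dist a b <= qed_dist b a.
Proof.
apply: lb_le_inf; first exact: lengths_neq0.
move=> _ [k [x [y [[k1 xb yx ya] ->]]]].
pose x' i := y (k.+1 - i)%N; pose y' i := x (k.+1 - i)%N.
have : chain a b k x' y'.
  split => //.
  - by rewrite /x' subn1.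
  - move=> i /andP[i1 ik]; rewrite /x' /y' subSS.
    apply/tree_equivE; rewrite subSn; last exact: ltnW.
    apply/esym/tree_equivE; apply: yx; rewrite subn_gt0 ik/=.
    by rewrite ltn_subrL i1 k1.
  - by rewrite /y' subSnn.
move=> /qed_dist_le_chain/le_trans; apply.
rewrite big_nat_rev/= le_eqVlt; apply/orP; left; apply/eqP.
apply: eq_big_nat => i /andP[i1 ik].
by rewrite /x' /y' d2C add1n subSS subKn// ltnW.
Qed.

Lemma qed_distC a b : qed_dist a b = qed_dist b a.
Proof. by apply/eqP; rewrite eq_le !qed_dist_le_sym. Qed.

Lemma qed_dist_triangle b a c : qed_dist a c <= qed_dist a b + qed_dist b c.
Proof.
apply/ler_addgt0Pr => e e0.
have e2 : 0 < e / 2 by rewrite divr_gt0.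
have [k [x [y [[k1 xa yx yb] sk]]]] :
    exists k x y, chain a b k x y /\
      \sum_(1 <= i < k.+1) d2 (x i) (y i) < qed_dist a b + e / 2.
  by apply: qed_dist_lt; rewrite ltrDl.
have [l [z [w [[l1 zb wz wc] sl]]]] :
    exists k x y, chain b c k x y /\
      \sum_(1 <= i < k.+1) d2 (x i) (y i) < qed_dist b c + e / 2.
  by apply: qed_dist_lt; rewrite ltrDl.
pose x' i := if (i <= k)%N then x i else z (i - k)%N.
pose y' i := if (i <= k)%N then y i else w (i - k)%N.
have c' : chain a c (k + l) x' y'.
  split.
  - by rewrite addn_gt0 k1.
  - by rewrite /x' k1.
  - move=> i /andP[i1 ikl]; rewrite /x' /y'; case: (ltngtP i k) => ik.
    + by apply: yx; rewrite i1.
    + rewrite subSn ?(ltnW ik)//; apply: wz; rewrite subn_gt0 ik/=.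
      by rewrite ltn_subLR // ltnW.
    + by apply/tree_equivE; rewrite ik subSnn yb zb.
  - by rewrite /y' leqNgt -[X in (X < _)%N]addn0 ltn_add2l l1/= addKn.
apply: le_trans (qed_dist_le_chain c') _.
rewrite (@big_cat_nat _ _ _ k.+1)//=; last by rewrite ltnS leq_addr.
rewrite [e]splitr addrACA; apply: lerD.
  apply: le_trans (ltW sk); rewrite le_eqVlt; apply/orP; left; apply/eqP.
  by apply: eq_big_nat => i /andP[_]; rewrite ltnS /x' /y' => ->.
apply: le_trans (ltW sl); rewrite le_eqVlt; apply/orP; left; apply/eqP.
rewrite -[k.+1]addn1 -addSn addnC [(k.+1 + l)%N]addSnnS [(k + _)%N]addnC.
rewrite big_addn addnK; apply: eq_big_nat => i /andP[i1 _].
by rewrite /x' /y' leqNgt -[X in (X < _)%N]add0n ltn_add2r i1/= addnK.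
Qed.

Let close_step (a x y : tree_preshape) (s e m : R) :
    (forall i, a i != 0 -> m < `|a i|) -> d2 x y <= e -> 0 <= s -> 0 <= e ->
    s + e <= m ->
  close s (collapse_children a) (collapse_children x) ->
  close (s + e) (collapse_children a) (collapse_children y).
Proof.
move=> am xy s0 e0 sem; rewrite -(prune_full x) => /(close_unprune s0) c.
rewrite -(prune_full y); apply: close_prune.
  exact: large_le sem (large_collapse am).
apply: close_nearf c _ => //; apply: nearf_full => i.
exact: le_trans (normr_le_d2 _ _ _) xy.
Qed.

Let close_chain (a b : tree_preshape) k x y (m : R) :
    (forall i, a i != 0 -> m < `|a i|) ->
    chain (to_shape a) (to_shape b) k x y ->
    \sum_(1 <= i < k.+1) d2 (x i) (y i) <= m ->
  close m (collapse_children a) (collapse_children b).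
Proof.
move=> am [k1 xa yx yb].
pose s l := \sum_(1 <= i < l.+1) d2 (x i) (y i).
have s0 l : 0 <= s l by apply: sumr_ge0 => i _; exact: d2_ge0.
have sS l : s l.+1 = s l + d2 (x l.+1) (y l.+1) by rewrite /s big_nat_recr.
have sle l l' : (l <= l')%N -> s l <= s l'.
  move/subnK <-; elim: (l' - l)%N => // i IH.
  by rewrite addSn sS (le_trans IH)// lerDl d2_ge0.
have col u v : to_shape u = to_shape v ->
    collapse_children u = collapse_children v by move/to_shapeP => -[].
rewrite -/(s k) => skm.
have main l : (l < k)%N ->
    close (s l.+1) (collapse_children a) (collapse_children (y l.+1)).
  elim: l => [|l IH] lk; rewrite sS; apply: (close_step (x := x _) am) => //;
    rewrite ?d2_ge0// -?sS ?(le_trans (sle _ _ lk) skm)//.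
  - by rewrite (col _ _ xa); exact: close_refl.
  - have /yx/tree_equivE/col <- : (1 <= l.+1 < k)%N by rewrite lk.
    by apply: IH; exact: ltnW.
have := main k.-1; rewrite prednK// leqnn => /(_ isT).
rewrite (col _ _ yb) => c; rewrite -(subrKC (s k) m).
have sm : 0 <= m - s k by rewrite subr_ge0.
apply: close_nearf c _ => //.
elim/(@forest_ind 'M[R]_(n, d)) : (collapse_children b) => [|? ? ? ? ?].
  exact: nearf_nil.
by constructor => //; rewrite subrr normr0.
Qed.

Let small (a : tree_preshape) : exists2 m : R, 0 < m &
  forall i, a i != 0 -> m < `|a i|.
Proof.
exists (\big[Num.min/1]_(i | a i != 0) `|a i| / 2) => [|i ai].
  rewrite divr_gt0//; elim/big_ind: _ => // [u v u0 v0|i ai].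
    by rewrite lt_min u0.
  by rewrite normr_gt0.
have : 0 < `|a i| by rewrite normr_gt0.
move=> ai0; rewrite ltr_pdivrMr//; apply: (@le_lt_trans _ _ `|a i|).
  by rewrite bigmin_le_cond.
by rewrite ltr_pMr// ltr1n.
Qed.

Lemma qed_dist_positivity a b : qed_dist a b = 0 -> a = b.
Proof.
have [x <-] := to_shape_surj a; have [y <-] := to_shape_surj b => xy0.
have [m m0 xm] := small x; have [m' m'0 ym] := small y.
apply/to_shapeP; congr ONode; apply: (@nearf_eq _ _ _ (Num.min m m')).
  by rewrite lt_min m0.
move=> e /andP[e0]; rewrite lt_min => /andP[em em'].
apply: close_large.
  by apply: (large_le (ltW em')); exact: large_collapse.
have [k [u [v [c /ltW ce]]]] : exists k u v,
    chain (to_shape x) (to_shape y) k u v /\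
    \sum_(1 <= i < k.+1) d2 (u i) (v i) < e.
  by apply: qed_dist_lt; rewrite xy0.
by apply: close_chain c ce => i /xm; exact: lt_trans.
Qed.

HB.instance Definition _ := isMetric.Build R tree_shape
  qed_distxx qed_dist_positivity qed_distC qed_dist_triangle.

End TreeShapes.

Arguments tree_preshape R d n T : clear implicits.
Arguments tree_shape R d n T : clear implicits.

(* Main.v *)
Require Import Defs.
From mathcomp Require Import all_boot all_order all_algebra.
From mathcomp Require Import all_classical all_reals topology normedtype.
From mathcomp Require Import ring lra.
Import Order.TTheory GRing.Theory Num.Theory.
Import numFieldNormedType.Exports.
Local Open Scope classical_set_scope.
Local Open Scope ring_scope.

(** A pre-shape with no zero edge is the only element of its class, because
    contracting an edge lowers the number of edges.  A chain starting at such a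
    pre-shape [y] and shorter than the smallest edge of [y] therefore never
    leaves the pre-shape space, so near a class without zero edges the QED
    metric is the Euclidean metric.  Everything else follows from Stewart's
    identity
      [|p - ((1-l)q + lr)|^2 = (1-l)|p-q|^2 + l|p-r|^2 - l(1-l)|q-r|^2]. *)

(** * Edge counts of full and collapsed trees *)

Section Counting.
Context {V : zmodType}.
Implicit Type t : bintree.

Lemma fsize_full t (x y : edge t -> V) : fsize (full x) = fsize (full y).
Proof.
elim: t x y => [//|l IHl r IHr] x y /=; rewrite !fsize_cons.
congr (_ + _).+1; first exact: IHl.
by congr (_ + _).+1; exact: IHr.
Qed.

Lemma fsize_contract_le (a : V) (c f : seq (V * otree V)) :
  (fsize c <= fsize f -> fsize (Defs.contract a c) <= (fsize f).+1)%N.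
Proof.
rewrite /Defs.contract; case: eqP => _ cf; first exact: leqW.
by rewrite fsize_cons addn0.
Qed.

Lemma fsize_collapse_le t (x : edge t -> V) :
  (fsize (collapse_children x) <= fsize (full x))%N.
Proof.
elim: t x => [//|l IHl r IHr] x /=; rewrite fsize_cat !fsize_cons addn0.
by rewrite -addSn; apply: leq_add; exact: fsize_contract_le.
Qed.

(** Contracting an edge strictly lowers the edge count and nothing raises it, so equal counts rule
    out every contraction. *)
Lemma collapse_fsize t (x : edge t -> V) :
  fsize (collapse_children x) = fsize (full x) -> collapse_children x = full x.
Proof.
have eq1 (a : V) (c f : seq (V * otree V)) : (fsize c <= fsize f)%N ->
    ((fsize f).+1 <= fsize (Defs.contract a c))%N ->
    Defs.contract a c = [:: (a, ONode c)] /\ fsize c = fsize f.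
  rewrite /Defs.contract; case: eqP => _ cf; first by rewrite ltnNge cf.
  rewrite fsize_cons addn0 ltnS => fc; split=> //.
  by apply/eqP; rewrite eqn_leq cf.
elim: t x => [//|l IHl r IHr] x /=; rewrite fsize_cat !fsize_cons addn0.
set cl := collapse_children _; set fl := full _.
set cr := collapse_children _; set fr := full _.
rewrite -addSn => E.
have cfl : (fsize cl <= fsize fl)%N by exact: fsize_collapse_le.
have cfr : (fsize cr <= fsize fr)%N by exact: fsize_collapse_le.
have cl1 := fsize_contract_le (x (inl None)) _ _ cfl.
have cr1 := fsize_contract_le (x (inr None)) _ _ cfr.
(* By [E] the two upper bounds [cl1] and [cr1] add up to the actual count, so each is attained;
   [eq1] then says that the top edge is kept and the count below it is full. *)
have [-> /IHl cfE] : Defs.contract (x (inl None)) cl =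
    [:: (x (inl None), ONode cl)] /\ fsize cl = fsize fl.
  by apply: eq1 => //; rewrite -(leq_add2r (fsize fr).+1) -E leq_add2l.
have [-> /IHr cfE'] : Defs.contract (x (inr None)) cr =
    [:: (x (inr None), ONode cr)] /\ fsize cr = fsize fr.
  by apply: eq1 => //; rewrite -(leq_add2l (fsize fl).+1) -E leq_add2r.
by rewrite [cl]cfE [cr]cfE'.
Qed.

Lemma collapse_neq0 t (x : edge t -> V) :
  (forall e, x e != 0) -> collapse_children x = full x.
Proof.
elim: t x => [//|l IHl r IHr] x x0 /=; rewrite /Defs.contract.
by rewrite !(negbTE (x0 _)) IHl ?IHr// => e; exact: x0.
Qed.

Lemma full_inj t (x y : edge t -> V) : full x = full y -> x =1 y.
Proof.
elim: t x y => [|l IHl r IHr] x y /=; first by move=> _ [].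
by move=> [a1 /IHl a2 b1 /IHr b2] [[e|]|[e|]].
Qed.

End Counting.

(** * Euclidean geometry of the pre-shape space *)

Section Euclidean.
Context {R : realType}.

Lemma enorm_ge0 p q (A : 'M[R]_(p, q)) : 0 <= enorm A.
Proof. exact: sqrtr_ge0. Qed.

Lemma enorm_sqr p q (A : 'M[R]_(p, q)) :
  enorm A ^+ 2 = \sum_i \sum_j A i j ^+ 2.
Proof.
by rewrite sqr_sqrtr//; do 2!(apply: sumr_ge0 => ? _); exact: sqr_ge0.
Qed.

Lemma stewart_enorm p q (A B C : 'M[R]_(p, q)) l :
  enorm (A - ((1 - l) *: B + l *: C)) ^+ 2 =
  (1 - l) * enorm (A - B) ^+ 2 + l * enorm (A - C) ^+ 2
    - l * (1 - l) * enorm (B - C) ^+ 2.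
Proof.
rewrite !enorm_sqr !mulr_sumr -sumrN -!big_split/=; apply: eq_bigr => i _.
rewrite !mulr_sumr -sumrN -!big_split/=; apply: eq_bigr => j _.
rewrite !mxE; ring.
Qed.

Context {d n : nat} {T : bintree}.
Local Notation pre := (tree_preshape R d n T).
Implicit Types (x y z p q r w : pre) (l s t : R).

Lemma d2_sqr x y : d2 x y ^+ 2 = \sum_e enorm (x e - y e) ^+ 2.
Proof. by rewrite sqr_sqrtr//; apply: sumr_ge0 => ? _; exact: sqr_ge0. Qed.

Lemma d2_eq0 x y : d2 x y = 0 -> x = y.
Proof.
move=> xy; apply/ffunP => e; apply/eqP; rewrite -subr_eq0 -normr_le0 -xy.
exact: normr_le_d2.
Qed.

Definition segment l x y : pre := [ffun e => (1 - l) *: x e + l *: y e].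

Lemma stewart l p q r : d2 p (segment l q r) ^+ 2 =
  (1 - l) * d2 p q ^+ 2 + l * d2 p r ^+ 2 - l * (1 - l) * d2 q r ^+ 2.
Proof.
rewrite !d2_sqr !mulr_sumr -sumrN -!big_split/=; apply: eq_bigr => e _.
by rewrite ffunE stewart_enorm.
Qed.

(* Stewart's identity at the point dividing [q r] in the ratio
   [d2 p q : d2 p r], whose distance to [p] has a nonnegative square. *)
Lemma d2_triangle p q r : d2 q r <= d2 q p + d2 p r.
Proof.
rewrite [d2 q p]d2C; set A := d2 p q; set B := d2 p r; set C := d2 q r.
have A0 : 0 <= A := d2_ge0 _ _; have B0 : 0 <= B := d2_ge0 _ _.
have C0 : 0 <= C := d2_ge0 _ _.
(* Zero distances are treated apart: the ratio divides by [A + B], and the last step cancels the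
   factor [A * B]. *)
have [A00|A1] := eqVneq A 0.
  by rewrite A00 add0r /C -(d2_eq0 _ _ A00).
have [B00|B1] := eqVneq B 0.
  by rewrite B00 addr0 /A /C -(d2_eq0 _ _ B00) d2C.
have {A1}A0 : 0 < A by rewrite lt_def A1.
have {B1}B0 : 0 < B by rewrite lt_def B1.
have AB : 0 < A + B by exact: addr_gt0.
have := stewart (A / (A + B)) p q r; rewrite -/A -/B -/C => E.
have {E}: 0 <= A * B * ((A + B) ^+ 2 - C ^+ 2).
  have <- : d2 p (segment (A / (A + B)) q r) ^+ 2 * (A + B) ^+ 2 =
      A * B * ((A + B) ^+ 2 - C ^+ 2) by rewrite E; field; exact: lt0r_neq0.
  by rewrite mulr_ge0// sqr_ge0.
rewrite pmulr_rge0 ?mulr_gt0// subr_ge0 ler_sqr ?nnegrE//; exact: ltW.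
Qed.

Lemma d2_segment s t y z :
  d2 (segment s y z) (segment t y z) = `|s - t| * d2 y z.
Proof.
apply: (@pexpIrn _ 2) => //; rewrite ?nnegrE ?mulr_ge0 ?d2_ge0//.
(* Stewart's identity seen from [y] and from [z] gives the distances of the first point to both
   ends; seen from the first point itself, it then gives the distance to the second. *)
have sy : d2 (segment s y z) y ^+ 2 = s ^+ 2 * d2 y z ^+ 2.
  by rewrite d2C (stewart s y y z) d2xx; ring.
have sz : d2 (segment s y z) z ^+ 2 = (1 - s) ^+ 2 * d2 y z ^+ 2.
  by rewrite d2C (stewart s z y z) d2xx (d2C z y); ring.
rewrite (stewart t (segment s y z) y z) sy sz exprMn.
by rewrite real_normK ?num_real//; ring.
Qed.

Lemma segment0 y z : segment 0 y z = y.
Proof. by apply/ffunP => e; rewrite ffunE subr0 scale1r scale0r addr0. Qed.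

Lemma segment1 y z : segment 1 y z = z.
Proof. by apply/ffunP => e; rewrite ffunE subrr scale1r scale0r add0r. Qed.

(** Equality case of the triangle inequality: with these distances the right-hand side of Stewart's
    identity at [w] vanishes. This is the source of uniqueness of geodesics. *)
Lemma segmentP l y z w :
  d2 y w = l * d2 y z -> d2 w z = (1 - l) * d2 y z -> w = segment l y z.
Proof.
move=> yw wz; apply: d2_eq0; apply/eqP; rewrite -sqrf_eq0 stewart.
rewrite [d2 w y]d2C yw wz; apply/eqP; ring.
Qed.

(** Convexity of balls: dropping the nonpositive last term of Stewart's identity leaves a convex
    combination of the squared distances to the ends. *)
Lemma segment_ball l x y z t : 0 <= l <= 1 ->
  d2 x y < t -> d2 x z < t -> d2 x (segment l y z) < t.
Proof.
move=> /andP[l0 l1] xy xz.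
have t0 : 0 < t by apply: le_lt_trans xy; exact: d2_ge0.
have xy2 : d2 x y ^+ 2 < t ^+ 2 by rewrite ltr_sqr ?nnegrE ?d2_ge0// ltW.
have xz2 : d2 x z ^+ 2 < t ^+ 2 by rewrite ltr_sqr ?nnegrE ?d2_ge0// ltW.
rewrite -ltr_sqr ?nnegrE ?d2_ge0 ?(ltW t0)// stewart.
pose m := Num.max (d2 x y ^+ 2) (d2 x z ^+ 2).
have mt : m < t ^+ 2 by rewrite gt_max xy2.
have l1' : 0 <= 1 - l by rewrite subr_ge0.
have ym : (1 - l) * d2 x y ^+ 2 <= (1 - l) * m.
  by rewrite ler_wpM2l// le_max lexx.
have zm : l * d2 x z ^+ 2 <= l * m by rewrite ler_wpM2l// le_max lexx orbT.
have yz : 0 <= l * (1 - l) * d2 y z ^+ 2.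
  by apply: mulr_ge0; [exact: mulr_ge0|exact: sqr_ge0].
lra.
Qed.

(** * The QED metric near classes without zero edges *)

Definition edges_ge t x : Prop := forall e, t <= `|x e|.

Lemma edges_ge_neq0 t x : 0 < t -> edges_ge t x -> forall e, x e != 0.
Proof. by move=> t0 xt e; rewrite -normr_gt0 (lt_le_trans t0). Qed.

Lemma edges_ge_d2 t s x y :
  edges_ge t x -> d2 x y <= s -> edges_ge (t - s) y.
Proof.
move=> xt xy e; rewrite lerBlDr (le_trans (xt e))//.
rewrite -[x e](subrKC (y e)) (le_trans (ler_normD _ _))// lerD2l.
exact: le_trans (normr_le_d2 _ _ _) xy.
Qed.

Lemma edges_geW t s x : s <= t -> edges_ge t x -> edges_ge s x.
Proof. by move=> st xt e; exact: le_trans st (xt e). Qed.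

Lemma edges_ge_exists x : (forall e, x e != 0) ->
  exists2 t, 0 < t & edges_ge t x.
Proof.
move=> x0; exists (\big[Num.min/1]_e `|x e|) => [|e].
  elim/big_ind: _ => // [u v u0 v0|e _]; first by rewrite lt_min u0.
  by rewrite normr_gt0.
by rewrite bigmin_le_cond.
Qed.

(** Only [x] is assumed to have no zero edge: the collapse of [y] has as many edges as the full
    tree, so nothing of [y] is contracted either. *)
Lemma to_shape_inj x y :
  (forall e, x e != 0) -> to_shape x = to_shape y -> x = y.
Proof.
move=> x0 /to_shapeP[]; rewrite collapse_neq0// => xy.
have yy : collapse_children y = full y.
  by apply: collapse_fsize; rewrite -xy; exact: fsize_full.
by apply/ffunP/full_inj; rewrite xy yy.
Qed.

Lemma d2_le_chain y z k (u v : nat -> pre) t :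
  edges_ge t y -> chain (to_shape y) (to_shape z) k u v ->
  \sum_(1 <= i < k.+1) d2 (u i) (v i) < t ->
  d2 y z <= \sum_(1 <= i < k.+1) d2 (u i) (v i).
Proof.
move=> yt [k1 uy vu vz].
pose s j := \sum_(1 <= i < j.+1) d2 (u i) (v i).
have sS j : s j.+1 = s j + d2 (u j.+1) (v j.+1) by rewrite /s big_nat_recr.
have sle i j : (i <= j)%N -> s i <= s j.
  move/subnK <-; elim: (j - i)%N => // h IH.
  by rewrite addSn sS (le_trans IH)// lerDl d2_ge0.
rewrite -/(s k) => skt.
(* The partial length [s j] stays below [t], so a pre-shape this close to [y] keeps edges of norm at
   least [t - s j > 0]. Its class is then a singleton, each jump of the chain is an equality, and
   the triangle inequality adds up the steps. *)
have neq0 w j : (j <= k)%N -> d2 y w <= s j -> forall e, w e != 0.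
  move=> jk yw; apply: (@edges_ge_neq0 (t - s j)).
    by rewrite subr_gt0 (le_lt_trans (sle _ _ jk)).
  exact: edges_ge_d2 yw.
have main j : (0 < j <= k)%N -> d2 y (v j) <= s j.
  elim: j => // -[|j] IH /andP[_ jk]; rewrite sS.
    have <- : y = u 1%N.
      apply: to_shape_inj; last by [].
      (* Index 0 has the empty sum as length, which covers [y] itself. *)
      by apply: (@neq0 _ 0%N) => //; rewrite d2xx /s big_geq.
    by rewrite lerDr /s big_geq.
  have yv := IH (ltnW jk).
  have <- : v j.+1 = u j.+2.
    apply: to_shape_inj; first exact: (neq0 _ j.+1 (ltnW jk)).
    by apply/tree_equivE/vu.
  by rewrite (le_trans (d2_triangle (v j.+1) _ _))// lerD2r.
have yvk : d2 y (v k) <= s k by apply: main; rewrite k1 /=.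
by rewrite -(to_shape_inj (v k) z)//; exact: (neq0 _ k).
Qed.

Lemma mdist_le_d2 y z : mdist (to_shape y) (to_shape z) <= d2 y z.
Proof. exact: qed_dist_le_d2. Qed.

Lemma mdist_d2 t y z : edges_ge t y ->
  mdist (to_shape y) (to_shape z) < t ->
  mdist (to_shape y) (to_shape z) = d2 y z.
Proof.
move=> yt yzt; apply/eqP; rewrite eq_le mdist_le_d2/=.
apply/ler_addgt0Pr => e e0.
(* The minimum makes the chain both almost optimal and short enough for [d2_le_chain]. *)
have [k [u [v [c]]]] : exists k (u v : nat -> pre),
    chain (to_shape y) (to_shape z) k u v /\
    \sum_(1 <= i < k.+1) d2 (u i) (v i) <
      Num.min (mdist (to_shape y) (to_shape z) + e) t.
  by apply: qed_dist_lt; rewrite lt_min yzt andbT ltrDl.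
rewrite lt_min => /andP[/ltW ske skt].
exact: le_trans (d2_le_chain _ _ _ _ _ _ yt c skt) ske.
Qed.

(** * Geodesics of shapes and segments of pre-shapes *)

Lemma geodesic_segment t y z (g : R -> tree_shape R d n T) l :
  edges_ge t y -> edges_ge t z -> mdist (to_shape y) (to_shape z) < t ->
  geodesic (to_shape y) (to_shape z) g -> 0 <= l <= 1 ->
  g (l * mdist (to_shape y) (to_shape z)) = to_shape (segment l y z).
Proof.
move=> yt zt yzt [g0 g1 gI] /andP[l0 l1].
set D := mdist _ _ in yzt g1 gI *.
have D0 : 0 <= D := mdist_ge0 _ _.
have lD : 0 <= l * D <= D by rewrite mulr_ge0//= ler_piMl.
have lDt : l * D < t by apply: le_lt_trans yzt; case/andP: lD.
have [w ww] := to_shape_surj (g (l * D)); rewrite -ww.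
have DE : D = d2 y z := mdist_d2 _ _ _ yt yzt.
have yw : mdist (to_shape y) (to_shape w) = l * D.
  rewrite ww -[in LHS]g0 gI ?in_itv/= ?lexx//.
  by rewrite sub0r normrN ger0_norm ?mulr_ge0.
have zw : mdist (to_shape z) (to_shape w) = (1 - l) * D.
  rewrite ww -[in LHS]g1 gI ?in_itv/= ?lexx ?D0//.
  rewrite mulrBl mul1r ger0_norm// subr_ge0; by case/andP: lD.
(* [mdist_d2] bounds the edges of one endpoint only, so it applies from [y] and from [z] although
   the edges of the lift [w] are not controlled. *)
congr to_shape; apply: segmentP; rewrite -DE.
- by rewrite -yw; apply/esym/(mdist_d2 _ _ _ yt); rewrite yw.
- rewrite d2C -zw; apply/esym/(mdist_d2 _ _ _ zt); rewrite zw.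
  by apply: le_lt_trans yzt; rewrite ler_piMl// gerBl.
Qed.

Lemma segment_geodesic t y z : edges_ge t y -> d2 y z < t / 2 ->
  geodesic (to_shape y) (to_shape z)
    (fun s => to_shape (segment (s / d2 y z) y z)).
Proof.
move=> yt yz; have D0 := d2_ge0 y z.
have DE : mdist (to_shape y) (to_shape z) = d2 y z.
  apply: (mdist_d2 _ _ _ yt); rewrite (le_lt_trans (mdist_le_d2 _ _))//; lra.
rewrite /geodesic DE; split.
- by rewrite mul0r segment0.
(* When [y = z] the quotient is a division by zero, but every point of the segment is then [z]. *)
- have [/d2_eq0 ->|D1] := eqVneq (d2 y z) 0; last by rewrite divff// segment1.
  congr to_shape; apply/ffunP => e; rewrite ffunE -scalerDl.
  by rewrite subrK scale1r.
- move=> a b; rewrite !in_itv/= => /andP[a0 aD] /andP[b0 bD].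
  have dE : d2 (segment (a / d2 y z) y z) (segment (b / d2 y z) y z) = `|a - b|.
    rewrite d2_segment; have [D1|D1] := eqVneq (d2 y z) 0.
      have -> : a = 0 by lra.
      have -> : b = 0 by lra.
      by rewrite D1 mulr0 subrr normr0.
    rewrite -mulrBl normrM [ `|_^-1|]ger0_norm ?invr_ge0//.
    by rewrite mulfVK.
  have abD : `|a - b| <= d2 y z by rewrite ler_norml; lra.
  (* The segment is shorter than [t / 2], so its points keep edges at least [t / 2], more than the
     distance between any two of them. *)
  have ya : edges_ge (t / 2) (segment (a / d2 y z) y z).
    apply: (@edges_geW (t - d2 y z)); first lra.
    apply: (edges_ge_d2 _ _ _ _ yt); rewrite -[X in d2 X _](segment0 y z).
    rewrite d2_segment sub0r normrN ger0_norm ?divr_ge0//.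
    have [->|D1] := eqVneq (d2 y z) 0; first by rewrite mulr0.
    by rewrite divfK.
  rewrite (mdist_d2 _ _ _ ya) ?dE//.
  by rewrite (le_lt_trans (mdist_le_d2 _ _))// dE (le_lt_trans abD).
Qed.

(** * Small balls around a class without zero edges *)

Section SmallBall.
Context {t : R} {x : pre}.
Hypotheses (t0 : 0 < t) (xt : edges_ge t x).
(** With radius [t / 8], members have edges at least [t / 2] and are less than [t / 4] apart, as
    [segment_geodesic] requires at scale [t / 2]. *)
Local Notation S := (ball (to_shape x) (t / 8)).

Lemma small_ball_d2 y : S (to_shape y) <-> d2 x y < t / 8.
Proof.
rewrite ballEmdist/=; split => xy; last first.
  exact: le_lt_trans (mdist_le_d2 _ _) xy.
rewrite -(mdist_d2 _ _ _ xt)//; apply: lt_trans xy _; move: t0; lra.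
Qed.

Lemma small_ball_edges y : S (to_shape y) -> edges_ge (t / 2) y.
Proof.
move/small_ball_d2/ltW/(edges_ge_d2 _ _ _ _ xt); apply: edges_geW.
by move: t0; lra.
Qed.

Lemma small_ball_d2_lt y z :
  S (to_shape y) -> S (to_shape z) -> d2 y z < t / 2 / 2.
Proof.
move=> /small_ball_d2 xy /small_ball_d2 xz.
apply: le_lt_trans (d2_triangle x _ _) _; rewrite d2C; move: t0; lra.
Qed.

Lemma small_ball_mdist y z : S (to_shape y) -> S (to_shape z) ->
  mdist (to_shape y) (to_shape z) = d2 y z.
Proof.
move=> Sy Sz; apply: (mdist_d2 _ _ _ (small_ball_edges _ Sy)).
apply: le_lt_trans (mdist_le_d2 _ _) _.
by apply: lt_trans (small_ball_d2_lt _ _ Sy Sz) _; move: t0; lra.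
Qed.

Lemma small_ball_geodesic y z : S (to_shape y) -> S (to_shape z) ->
  geodesic_in S (to_shape y) (to_shape z)
    (fun s => to_shape (segment (s / d2 y z) y z)).
Proof.
move=> Sy Sz; split.
  exact: segment_geodesic (small_ball_edges _ Sy) (small_ball_d2_lt _ _ Sy Sz).
move=> s; rewrite in_itv/= small_ball_mdist// => /andP[s0 sD].
apply/small_ball_d2/segment_ball; [|exact/small_ball_d2..].
rewrite divr_ge0 ?d2_ge0//=; have [->|D1] := eqVneq (d2 y z) 0.
  by rewrite invr0 mulr0.
by rewrite ler_pdivrMr ?mul1r// lt_def D1 d2_ge0.
Qed.

Lemma small_ball_geodesicE y z g l : S (to_shape y) -> S (to_shape z) ->
  geodesic (to_shape y) (to_shape z) g -> 0 <= l <= 1 ->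
  g (l * mdist (to_shape y) (to_shape z)) = to_shape (segment l y z).
Proof.
move=> Sy Sz; apply: geodesic_segment; try exact: small_ball_edges.
rewrite small_ball_mdist// (lt_trans (small_ball_d2_lt _ _ Sy Sz))//.
by move: t0; lra.
Qed.

Lemma small_ball_CAT0 : CAT0 S.
Proof.
split=> [a b|a b c gab gbc gac].
  have [y <-] := to_shape_surj a; have [z <-] := to_shape_surj b => Sy Sz.
  eexists; exact: small_ball_geodesic.
have [p <-] := to_shape_surj a; have [q <-] := to_shape_surj b.
have [r <-] := to_shape_surj c => Sp Sq Sr _ [gqr _] _ P Q C.
rewrite (small_ball_mdist p q)// (small_ball_mdist p r)// => PQ QC PC l l01.
rewrite small_ball_geodesicE//; apply: le_trans (mdist_le_d2 _ _) _.
(* Both squares expand by Stewart's identity into the same expression in the three side lengths. *)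
rewrite -ler_sqr ?nnegrE ?d2_ge0 ?enorm_ge0// stewart stewart_enorm.
by rewrite PQ PC QC small_ball_mdist.
Qed.

Lemma small_ball_unique y z g g' : S (to_shape y) -> S (to_shape z) ->
  geodesic (to_shape y) (to_shape z) g ->
  geodesic (to_shape y) (to_shape z) g' ->
  {in `[0, mdist (to_shape y) (to_shape z)], g' =1 g}.
Proof.
move=> Sy Sz yg yg' s; rewrite in_itv/=; set D := mdist _ _ => /andP[s0 sD].
have [l l01 ->] : exists2 l, 0 <= l <= 1 & s = l * D.
  have [D1|D1] := eqVneq D 0.
    by exists 0; rewrite ?lexx ?ler01// mul0r; move: t0; lra.
  have D0 : 0 < D by rewrite lt_def D1 (le_trans s0).
  by exists (s / D); rewrite ?mulfVK// divr_ge0 ?(ltW D0)//= ler_pdivrMr ?mul1r.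
by rewrite /D !small_ball_geodesicE.
Qed.

End SmallBall.

Lemma locally_CAT0_neq0 x : (forall e, x e != 0) -> locally_CAT0 (to_shape x).
Proof.
move=> /edges_ge_exists[t t0 xt]; exists (t / 8); first by rewrite divr_gt0.
exact: small_ball_CAT0.
Qed.

Lemma locally_unique_neq0 x : (forall e, x e != 0) ->
  locally_unique_geodesics (to_shape x).
Proof.
move=> /edges_ge_exists[t t0 xt]; exists (ball (to_shape x) (t / 8)).
  by apply: nbhsx_ballx; rewrite divr_gt0.
move=> a b; have [y <-] := to_shape_surj a; have [z <-] := to_shape_surj b.
move=> Sy Sz; have yz := small_ball_geodesic t0 xt _ _ Sy Sz.
eexists; first exact: yz.
by move=> g' yg'; apply: (small_ball_unique t0 xt) => //; case: yz.
Qed.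

(** * Openness and density of the classes without zero edges *)

Definition binary_shapes : set (tree_shape R d n T) :=
  [set a | exists2 x, a = to_shape x & forall e, x e != 0].

Lemma open_binary_shapes : open binary_shapes.
Proof.
rewrite openE => _ [x -> /edges_ge_exists[t t0 xt]].
apply/nbhs_ballP; exists t => //= b; have [y <-] := to_shape_surj b.
rewrite ballEmdist/= => xy; exists y => //.
apply: (@edges_ge_neq0 (t - d2 x y)); last exact: edges_ge_d2 xt _.
by rewrite subr_gt0 -(mdist_d2 _ _ _ xt).
Qed.

Lemma dense_binary_shapes : (0 < d)%N -> (0 < n)%N -> dense binary_shapes.
Proof.
move=> d0 n0 O [a Oa]; rewrite openE => /(_ _ Oa)/nbhs_ballP[e /= e0].
have [x <-] := to_shape_surj a => xO.
(* Moving from [x] towards [v] changes only the zero edges; the all-ones matrix is nonzero because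
   [d] and [n] are positive. *)
pose v : pre := [ffun i => if x i == 0 then const_mx 1 else x i].
have D0 : 0 < d2 x v + 1 by rewrite ltr_wpDl ?d2_ge0.
(* The displacement is [c * d2 x v < e]; adding 1 keeps the denominator positive when [x = v]. *)
pose c := e / (d2 x v + 1); have c0 : 0 < c by rewrite divr_gt0.
exists (to_shape (segment c x v)); split.
  apply: xO; rewrite ballEmdist/=; apply: le_lt_trans (mdist_le_d2 _ _) _.
  rewrite -[X in d2 X _](segment0 x v) d2_segment sub0r normrN gtr0_norm//.
  by rewrite mulrAC ltr_pdivrMr// ltr_pM2l// ltrDl.
exists (segment c x v) => // i; rewrite !ffunE; case: ifPn => [/eqP->|xi].
  rewrite scaler0 add0r scaler_eq0 (gt_eqF c0)/=; apply/eqP => /matrixP.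
  move=> /(_ (Ordinal n0) (Ordinal d0)); rewrite !mxE; exact/eqP/oner_neq0.
by rewrite -scalerDl subrK scale1r.
Qed.

End Euclidean.

Theorem theorem33 (R : realType) (d n : nat) (T : bintree)
    (d_gt0 : (1 <= d)%N) (n_gt0 : (1 <= n)%N) (edges : (0 < #|edge T|)%N) :
  generic (fun a : tree_shape R d n T =>
    locally_CAT0 a /\ \forall b \near a, locally_unique_geodesics b).
Proof.
exists binary_shapes; split.
- exact: open_binary_shapes.
- exact: dense_binary_shapes.
- move=> a Ua; split; first by case: Ua => x ->; exact: locally_CAT0_neq0.
  (* By openness, all classes near [a] are again without zero edges. *)
  apply: filterS (open_nbhs_nbhs (conj open_binary_shapes Ua)).
  by move=> _ [x -> ]; exact: locally_unique_neq0.
Qed.
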